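(* Let $(\mathsf H_i)_{i\in\mathbb I}$ be an at most countable family of real Hilbert spaces, let $\mathcal H=\bigoplus_{i\in\mathbb I}\mathsf H_i$ be their Hilbert direct sum, let $\overline x\in\mathcal H$, and let $(\overline{\mathsf x}_i)_{i\in\mathbb I}$ be its decomposition, i.e., $(\forall i\in\mathbb I)$ $\overline{\mathsf x}_i\in\mathsf H_i$. For every $i\in\mathbb I$, let $\omega_i\in\,]0,+\infty[$, let $\mathsf C_i$ be a nonempty closed convex subset of $\mathsf H_i$, set $$\mathsf Q_i\colon\mathsf H_i\to\mathsf H_i\colon\mathsf x_i\mapsto\begin{cases}\mathsf x_i,&\text{if }d_{\mathsf C_i}(\mathsf x_i)>\omega_i;\\ \operatorname{proj}_{\mathsf C_i}\mathsf x_i,&\text{if }d_{\mathsf C_i}(\mathsf x_i)\leq\omega_i,\end{cases}$$ and let $\mathsf q_i=\mathsf Q_i\overline{\mathsf x}_i$. If $\mathbb I$ is infinite, suppose that $(\forall i\in\mathbb I)$ $\mathsf 0\in\mathsf C_i$. Further, for every $i\in\mathbb I$, set $$\mathsf S_i\colon\mathsf H_i\to\mathsf H_i\colon\mathsf x_i\mapsto\begin{cases}\mathsf x_i+\dfrac{\omega_i}{d_{\mathsf C_i}(\mathsf x_i)}(\operatorname{proj}_{\mathsf C_i}\mathsf x_i-\mathsf x_i),&\text{if }\mathsf x_i\notin\mathsf C_i;\\ \mathsf x_i,&\text{if }\mathsf x_i\in\mathsf C_i,\end{cases}$$ $\mathsf F_i=\mathsf S_i\circ\mathsf Q_i$, and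 $\mathsf p_i=\mathsf S_i\mathsf q_i$. Finally, set $p=(\mathsf p_i)_{i\in\mathbb I}$ and $f\colon\mathcal H\to\,]-\infty,+\infty]\colon(\mathsf x_i)_{i\in\mathbb I}\mapsto\sum_{i\in\mathbb I}\omega_id_{\mathsf C_i}(\mathsf x_i)$. Then the following hold: (i) For every $i\in\mathbb I$, $\mathsf F_i=\operatorname{prox}_{\omega_id_{\mathsf C_i}}$. (ii) $p$ is the proximal point of $\overline x$ relative to $f$, i.e., $p=\operatorname{prox}_f\overline x$. (iii) Let $x=(\mathsf x_i)_{i\in\mathbb I}\in\mathcal H$. Then $\big[(\forall i\in\mathbb I)\ \mathsf Q_i\mathsf x_i=\mathsf q_i\big]\Leftrightarrow\operatorname{prox}_fx=p$.
   Context: For a nonempty closed convex subset $\mathsf C$ of a Hilbert space, $d_{\mathsf C}$ is the distance function to $\mathsf C$ and $\operatorname{proj}_{\mathsf C}$ the metric projector onto $\mathsf C$. For a proper lower semicontinuous convex function $g\colon\mathcal G\to\,]-\infty,+\infty]$ on a real Hilbert space $\mathcal G$ and $x\in\mathcal G$, $\operatorname{prox}_gx$ is the unique minimizer of $y\mapsto g(y)+\frac12\|x-y\|^2$; it is called the proximal point of $x$ relative to $g$. The Hilbert direct sum $\bigoplus_{i\in\mathbb I}\mathsf H_i$ consists of all families $(\mathsf x_i)_{i\in\mathbb I}$ with $\mathsf x_i\in\mathsf H_i$ and $\sum_{i\in\mathbb I}\|\mathsf x_i\|^2<+\infty$. *)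

(* Defs.v *)
From HB Require Import structures.
From mathcomp Require Import all_boot all_order all_algebra finmap.
From mathcomp Require Import all_classical all_reals all_analysis.
From mathcomp Require Import ring lra.

Set Implicit Arguments.
Unset Strict Implicit.
Unset Printing Implicit Defensive.

Import Order.TTheory GRing.Theory Num.Theory.
Import numFieldNormedType.Exports.

Local Open Scope classical_set_scope.
Local Open Scope ring_scope.

HB.mixin Record CompleteNormedModule_isHilbert (R : realType) V
    & CompleteNormedModule R V := {
  inner : V -> V -> R ;
  innerC : forall x y, inner x y = inner y x ;
  innerDl : forall x y z, inner (x + y) z = inner x z + inner y z ;
  innerZl : forall (a : R) x y, inner (a *: x) y = a * inner x y ;
  inner_normE : forall x, inner x x = `|x| ^+ 2
}.

#[short(type="hilbertType")]
HB.structure Definition Hilbert (R : realType) :=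
  {V of CompleteNormedModule R V & CompleteNormedModule_isHilbert R V}.

Section inner_theory.
Context {R : realType} {V : hilbertType R}.
Implicit Types x y z : V.

Lemma innerDr x y z : inner x (y + z) = inner x y + inner x z.
Proof. by rewrite innerC innerDl !(innerC x). Qed.

Lemma innerZr (a : R) x y : inner x (a *: y) = a * inner x y.
Proof. by rewrite innerC innerZl innerC. Qed.

Lemma normD_sqr x y :
  `|x + y| ^+ 2 = `|x| ^+ 2 + 2 * inner x y + `|y| ^+ 2.
Proof. by rewrite -!inner_normE !(innerDl, innerDr) (innerC y x); ring. Qed.

End inner_theory.

Section nonnegative_sums.
Context {R : realType} {I : choiceType}.
Implicit Types a b : I -> R.

Local Notation esumT a := (\esum_(i in [set: I]) (a i)%:E)%E.

Lemma esumT_ge0 a : (forall i, 0 <= a i) -> (0 <= esumT a)%E.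
Proof. by move=> a0; apply: esum_ge0 => i _; rewrite lee_fin. Qed.

Lemma esumT_fin a : (forall i, 0 <= a i) -> (esumT a < +oo)%E ->
  esumT a \is a fin_num.
Proof. by move=> a0 afin; rewrite ge0_fin_numE// esumT_ge0. Qed.

Lemma esumTD a b : (forall i, 0 <= a i) -> (forall i, 0 <= b i) ->
  (esumT (fun i => a i + b i)%R = esumT a + esumT b)%E.
Proof.
move=> a0 b0; rewrite -esumD; last 2 first.
- by move=> i _; rewrite lee_fin.
- by move=> i _; rewrite lee_fin.
by apply: eq_esum => i _; rewrite EFinD.
Qed.

Lemma le_esumT a b : (forall i, a i <= b i) -> (esumT a <= esumT b)%E.
Proof. by move=> ab; apply: le_esum => i _; rewrite lee_fin. Qed.

Lemma le_esumTZ (c : R) a : 0 <= c -> (forall i, 0 <= a i) ->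
  (esumT (fun i => c * a i)%R <= c%:E * esumT a)%E.
Proof.
move=> c0 a0; apply: ge_ereal_sup => _ [A [finA AT] <-].
under eq_fsbigr do rewrite EFinM.
rewrite -ge0_mule_fsumr; last by move=> i; rewrite lee_fin.
apply: lee_wpmul2l; first by rewrite lee_fin.
by apply: esum_ge; exists A.
Qed.

Lemma esumTZ (c : R) a : 0 <= c -> (forall i, 0 <= a i) ->
  (esumT (fun i => c * a i)%R = c%:E * esumT a)%E.
Proof.
move=> c0 a0; apply/eqP; rewrite eq_le le_esumTZ//=.
have [->|cn0] := eqVneq c 0.
  by rewrite mul0e esum_ge0// => i _; rewrite mul0r.
have cgt0 : 0 < c by rewrite lt_def cn0.
have ca0 i : 0 <= c * a i by rewrite mulr_ge0.
have ci0 : 0 <= c^-1 by rewrite invr_ge0.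
have := le_esumTZ ci0 ca0; under eq_esum do rewrite mulKf//.
move=> /(lee_wpmul2l (x := c%:E)).
rewrite lee_fin => /(_ c0) /le_trans; apply.
by rewrite muleA -EFinM mulfV// mul1e.
Qed.

End nonnegative_sums.

Section hilbert_direct_sum.
Context {R : realType} {I : choiceType} (H : I -> hilbertType R).

Definition square_summable (x : forall i, H i) : bool :=
  (\esum_(i in [set: I]) (`|x i| ^+ 2)%:E < +oo)%E.

Record hilbert_sum := HilbertSum {
  hilbert_sum_fun :> forall i, H i ;
  hilbert_sumP : square_summable hilbert_sum_fun
}.

HB.instance Definition _ := gen_eqMixin hilbert_sum.
HB.instance Definition _ := gen_choiceMixin hilbert_sum.

Lemma hilbert_sum_ext (x y : hilbert_sum) : (forall i, x i = y i) -> x = y.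
Proof.
case: x y => [x xP] [y yP] /= xy.
have {}xy : x = y by exact/functional_extensionality_dep.
by subst y; congr HilbertSum; exact: bool_irrelevance.
Qed.

Lemma square_summable0 : square_summable (fun i => 0 : H i).
Proof. by rewrite /square_summable esum1// => i _; rewrite normr0 expr0n. Qed.

Lemma square_summableZ (a : R) x :
  square_summable x -> square_summable (fun i => a *: x i).
Proof.
rewrite /square_summable => xoo; under eq_esum do rewrite normrZ exprMn.
rewrite esumTZ ?sqr_ge0//.
by rewrite lte_mul_pinfty// ?lee_fin ?sqr_ge0.
Qed.

Lemma square_summableD x y : square_summable x -> square_summable y ->
  square_summable (fun i => x i + y i).
Proof.
rewrite /square_summable => xoo yoo.
apply: (@le_lt_trans _ _ (\esum_(i in [set: I])
    (2 * `|x i| ^+ 2 + 2 * `|y i| ^+ 2)%:E)%E).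
  apply: le_esumT => i.
  have : `|x i + y i| ^+ 2 <= (`|x i| + `|y i|) ^+ 2.
    by rewrite lerXn2r ?nnegrE ?addr_ge0// ler_normD.
  by move=> /le_trans; apply; have := sqr_ge0 (`|x i| - `|y i|); nra.
have n0 (z : forall i, H i) i : 0 <= 2 * `|z i| ^+ 2.
  by rewrite mulr_ge0// sqr_ge0.
rewrite esumTD//.
rewrite !esumTZ//.
by rewrite lte_add_pinfty// lte_mul_pinfty.
Qed.

Lemma square_summableN x : square_summable x -> square_summable (fun i => - x i).
Proof.
by rewrite /square_summable; under eq_esum do rewrite -normrN.
Qed.

Definition hilbert_sum0 := HilbertSum square_summable0.
Definition hilbert_sumD (x y : hilbert_sum) :=
  HilbertSum (square_summableD (hilbert_sumP x) (hilbert_sumP y)).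
Definition hilbert_sumN (x : hilbert_sum) :=
  HilbertSum (square_summableN (hilbert_sumP x)).
Definition hilbert_sumZ (a : R) (x : hilbert_sum) :=
  HilbertSum (square_summableZ a (hilbert_sumP x)).

Let addA : associative hilbert_sumD.
Proof. by move=> x y z; apply: hilbert_sum_ext => i /=; rewrite addrA. Qed.

Let addC : commutative hilbert_sumD.
Proof. by move=> x y; apply: hilbert_sum_ext => i /=; rewrite addrC. Qed.

Let add0 : left_id hilbert_sum0 hilbert_sumD.
Proof. by move=> x; apply: hilbert_sum_ext => i /=; rewrite add0r. Qed.

Let addN : left_inverse hilbert_sum0 hilbert_sumN hilbert_sumD.
Proof. by move=> x; apply: hilbert_sum_ext => i /=; rewrite addNr. Qed.

HB.instance Definition _ :=
  GRing.isZmodule.Build hilbert_sum addA addC add0 addN.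

Let scaleA a b x :
  hilbert_sumZ a (hilbert_sumZ b x) = hilbert_sumZ (a * b) x.
Proof. by apply: hilbert_sum_ext => i /=; rewrite scalerA. Qed.

Let scale1 : left_id 1 hilbert_sumZ.
Proof. by move=> x; apply: hilbert_sum_ext => i /=; rewrite scale1r. Qed.

Let scaleDr : right_distributive hilbert_sumZ +%R.
Proof. by move=> a x y; apply: hilbert_sum_ext => i /=; rewrite scalerDr. Qed.

Let scaleDl x : {morph hilbert_sumZ^~ x : a b / a + b}.
Proof. by move=> a b; apply: hilbert_sum_ext => i /=; rewrite scalerDl. Qed.

HB.instance Definition _ :=
  GRing.Zmodule_isLmodule.Build R hilbert_sum scaleA scale1 scaleDr scaleDl.

Lemma hilbert_sumDE (x y : hilbert_sum) i : (x + y) i = x i + y i.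
Proof. by []. Qed.

Lemma hilbert_sumNE (x : hilbert_sum) i : (- x) i = - x i.
Proof. by []. Qed.

Lemma hilbert_sumZE a (x : hilbert_sum) i : (a *: x) i = a *: x i.
Proof. by []. Qed.

Lemma hilbert_sum0E i : (0 : hilbert_sum) i = 0.
Proof. by []. Qed.

Definition sqnorm (x : hilbert_sum) : R :=
  fine (\esum_(i in [set: I]) (`|x i| ^+ 2)%:E)%E.

Lemma EFin_sqnorm x :
  (sqnorm x)%:E = (\esum_(i in [set: I]) (`|x i| ^+ 2)%:E)%E.
Proof.
rewrite /sqnorm fineK//; apply: esumT_fin; last exact: hilbert_sumP.
by move=> i; exact: sqr_ge0.
Qed.

Lemma sqnorm_ge0 x : 0 <= sqnorm x.
Proof. by rewrite -lee_fin EFin_sqnorm; apply: esumT_ge0 => i; exact: sqr_ge0. Qed.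

Lemma sqnormZ a x : sqnorm (a *: x) = a ^+ 2 * sqnorm x.
Proof.
apply: EFin_inj; rewrite EFinM !EFin_sqnorm -esumTZ ?sqr_ge0//.
by apply: eq_esum => i _; rewrite hilbert_sumZE normrZ exprMn real_normK ?num_real.
Qed.

Lemma coord_le_sqnorm (x : hilbert_sum) i : `|x i| ^+ 2 <= sqnorm x.
Proof.
rewrite -lee_fin EFin_sqnorm; apply: esum_ge.
by exists [set i]; rewrite ?fsbig_set1//; split.
Qed.

(* The scalar product \sum_i <x_i, y_i>, given by polarization of the squared
   norm so that only sums of nonnegative families are involved. *)
Definition hilbert_sum_inner (x y : hilbert_sum) : R :=
  (sqnorm (x + y) - sqnorm x - sqnorm y) / 2.

Lemma hilbert_sum_innerC x y : hilbert_sum_inner x y = hilbert_sum_inner y x.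
Proof. by rewrite /hilbert_sum_inner (addrC x y); congr (_ / 2); ring. Qed.

Lemma hilbert_sum_innerDl x y z : hilbert_sum_inner (x + y) z =
  hilbert_sum_inner x z + hilbert_sum_inner y z.
Proof.
suff E : sqnorm (x + y + z) + (sqnorm x + (sqnorm y + sqnorm z)) =
    sqnorm (x + y) + (sqnorm (x + z) + sqnorm (y + z)).
  by rewrite /hilbert_sum_inner; lra.
have n0 (u : hilbert_sum) i : 0 <= `|u i| ^+ 2 by exact: sqr_ge0.
apply: EFin_inj; rewrite !EFinD !EFin_sqnorm.
rewrite -!esumTD//; try by move=> i; rewrite ?addr_ge0.
apply: eq_esum => i _; congr (_%:E).
rewrite !hilbert_sumDE !normD_sqr !innerDl; ring.
Qed.

Lemma hilbert_sum_innerZl a x y :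
  hilbert_sum_inner (a *: x) y = a * hilbert_sum_inner x y.
Proof.
wlog a0 : a / 0 <= a.
  move=> W; have [/W//|a0] := leP 0 a.
  have h0 : hilbert_sum_inner 0 y = 0.
    by have := hilbert_sum_innerDl 0 0 y; rewrite addr0; lra.
  have := hilbert_sum_innerDl (a *: x) (- a *: x) y.
  rewrite scaleNr subrr h0 -scaleNr (W (- a)); last by rewrite oppr_ge0 ltW.
  lra.
suff E : sqnorm (a *: x + y) + (a * sqnorm x + a * sqnorm y) =
    a * sqnorm (x + y) + (a ^+ 2 * sqnorm x + sqnorm y).
  by rewrite /hilbert_sum_inner sqnormZ; lra.
have n0 (u : hilbert_sum) i : 0 <= `|u i| ^+ 2 by exact: sqr_ge0.
have an0 (u : hilbert_sum) i : 0 <= a * `|u i| ^+ 2 by exact: mulr_ge0.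
have a2 : 0 <= a ^+ 2 by exact: sqr_ge0.
have a2n0 (u : hilbert_sum) i : 0 <= a ^+ 2 * `|u i| ^+ 2 by exact: mulr_ge0.
apply: EFin_inj; rewrite !EFinD !EFinM !EFin_sqnorm -?EFinM.
rewrite -!esumTZ// -!esumTD//; try by move=> i; rewrite ?addr_ge0.
apply: eq_esum => i _; congr (_%:E).
rewrite !hilbert_sumDE !normD_sqr innerZl normrZ exprMn ger0_norm//; ring.
Qed.

Lemma hilbert_sum_inner_sqnorm x : hilbert_sum_inner x x = sqnorm x.
Proof.
rewrite /hilbert_sum_inner -[in X in sqnorm X](scale1r x) -scalerDl sqnormZ.
by field.
Qed.

Definition hilbert_sum_norm (x : hilbert_sum) : R := Num.sqrt (sqnorm x).

Lemma sqr_hilbert_sum_norm x : hilbert_sum_norm x ^+ 2 = sqnorm x.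
Proof. by rewrite sqr_sqrtr// sqnorm_ge0. Qed.

Lemma hilbert_sum_inner_le x y :
  hilbert_sum_inner x y <= hilbert_sum_norm x * hilbert_sum_norm y.
Proof.
set s := hilbert_sum_norm x; set t := hilbert_sum_norm y.
have s0 : 0 <= s by exact: sqrtr_ge0.
have t0 : 0 <= t by exact: sqrtr_ge0.
have key (a b : R) : 0 <= a ^+ 2 * s ^+ 2 + b ^+ 2 * t ^+ 2
    - 2 * (a * b * hilbert_sum_inner x y).
  have := sqnorm_ge0 (a *: x + (- b) *: y).
  rewrite -hilbert_sum_inner_sqnorm hilbert_sum_innerDl.
  rewrite (hilbert_sum_innerC (a *: x)) (hilbert_sum_innerC (- b *: y)).
  rewrite !hilbert_sum_innerDl !hilbert_sum_innerZl.
  rewrite (hilbert_sum_innerC _ (a *: x)) (hilbert_sum_innerC _ (- b *: y)).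
  rewrite ![hilbert_sum_inner _ (_ *: _)]hilbert_sum_innerC.
  rewrite !hilbert_sum_innerZl !hilbert_sum_inner_sqnorm.
  rewrite -!sqr_hilbert_sum_norm -/s -/t (hilbert_sum_innerC y x).
  by move=> h; apply: (le_trans h); lra.
have [st|st] := eqVneq (s * t) 0.
  rewrite st leNgt; apply/negP => p0.
  have /eqP := st; rewrite mulf_eq0 => /orP[]/eqP z0.
    have := key (t ^+ 2 + 1) (hilbert_sum_inner x y); rewrite z0 => h.
    have : 0 < hilbert_sum_inner x y ^+ 2 * (t ^+ 2 + 2).
      by rewrite mulr_gt0// ?exprn_gt0// ltr_wpDl// sqr_ge0.
    by nra.
  have := key (hilbert_sum_inner x y) (s ^+ 2 + 1); rewrite z0 => h.
  have : 0 < hilbert_sum_inner x y ^+ 2 * (s ^+ 2 + 2).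
    by rewrite mulr_gt0// ?exprn_gt0// ltr_wpDl// sqr_ge0.
  by nra.
have stp : 0 < s * t by rewrite lt_def st mulr_ge0.
have := key t s => h.
rewrite -(ler_pM2l stp) -subr_ge0.
have -> : s * t * (s * t) - s * t * hilbert_sum_inner x y =
  (t ^+ 2 * s ^+ 2 + s ^+ 2 * t ^+ 2
    - 2 * (t * s * hilbert_sum_inner x y)) / 2 by field.
by rewrite divr_ge0.
Qed.

Let norm_ler_D x y :
  hilbert_sum_norm (x + y) <= hilbert_sum_norm x + hilbert_sum_norm y.
Proof.
have p0 z : 0 <= hilbert_sum_norm z by exact: sqrtr_ge0.
rewrite -(@ler_pXn2r _ 2)// ?nnegrE ?addr_ge0//.
have := hilbert_sum_inner_le x y.
have : sqnorm (x + y) = sqnorm x + 2 * hilbert_sum_inner x y + sqnorm y.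
  by rewrite /hilbert_sum_inner; field.
by rewrite -!sqr_hilbert_sum_norm; nra.
Qed.

Let norm_Z (a : R) x : hilbert_sum_norm (a *: x) = `|a| * hilbert_sum_norm x.
Proof.
by rewrite /hilbert_sum_norm sqnormZ sqrtrM ?sqr_ge0// sqrtr_sqr.
Qed.

Let norm_eq0 x : hilbert_sum_norm x = 0 -> x = 0.
Proof.
move=> x0; apply: hilbert_sum_ext => i; rewrite hilbert_sum0E.
have := coord_le_sqnorm x i.
rewrite -sqr_hilbert_sum_norm x0 expr0n/= => xi0.
apply/eqP; rewrite -normr_eq0 -sqrf_eq0 eq_le xi0/=.
exact: sqr_ge0.
Qed.

HB.instance Definition _ :=
  @Lmodule_isNormed.Build R hilbert_sum hilbert_sum_norm
    norm_ler_D norm_Z norm_eq0.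

Lemma hilbert_sum_normE (x : hilbert_sum) :
  (`|x| ^+ 2)%:E = (\esum_(i in [set: I]) (`|x i| ^+ 2)%:E)%E.
Proof. by rewrite -EFin_sqnorm -sqr_hilbert_sum_norm. Qed.

Lemma coord_le_norm (x : hilbert_sum) i : `|x i| <= `|x|.
Proof.
rewrite -(@ler_pXn2r _ 2)// ?nnegrE//.
by rewrite [in leRHS]/Num.norm/= sqr_hilbert_sum_norm coord_le_sqnorm.
Qed.

Lemma coord_cauchy (F : set_system hilbert_sum) (i : I) :
  ProperFilter F -> cauchy F -> cauchy ((fun x : hilbert_sum => x i) @ F).
Proof.
move=> FF /cauchy_ballP Fc; apply/cauchy_ballP => e e0.
have [[U V] /= [FU FV] UV] := Fc _ e0.
exists ((fun x : hilbert_sum => x i) @` U, (fun x : hilbert_sum => x i) @` V).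
  split => /=.
    by apply: filterS FU => x Ux; exists x.
  by apply: filterS FV => x Ux; exists x.
move=> [_ _] [/= [x Ux <-] [y Vy <-]].
have := UV (x, y) (conj Ux Vy); rewrite -!ball_normE /ball_/=.
by apply: le_lt_trans; exact: (coord_le_norm (x - y)).
Qed.

Lemma hilbert_sum_complete (F : set_system hilbert_sum) :
  ProperFilter F -> cauchy F -> cvg F.
Proof.
move=> FF Fc.
pose l i : H i := lim ((fun x : hilbert_sum => x i) @ F).
have Fl i : (fun x : hilbert_sum => x i) @ F --> l i.
  by apply: cauchy_cvg; exact: coord_cauchy.
have key e : 0 < e -> \forall x \near F,
    (\esum_(i in [set: I]) (`|(x : hilbert_sum) i - l i| ^+ 2)%:E
       <= (e ^+ 2)%:E)%E.
  move=> e0; have /cauchy_ballP := Fc => /(_ e e0)[[U V] /= [FU FV] UV].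
  apply: filterS FU => x Ux.
  apply: ge_ereal_sup => _ [A [finA _] <-].
  rewrite fsbig_finite//= sumEFin lee_fin.
  have cvs : \sum_(i <- fset_set A) `|x i - (y : hilbert_sum) i| ^+ 2
      @[y --> F] --> \sum_(i <- fset_set A) `|x i - l i| ^+ 2.
    apply: cvg_big => [|i _]; first exact: add_continuous.
    have h : `|x i - (y : hilbert_sum) i| @[y --> F] --> `|x i - l i|.
      by apply: cvg_norm; apply: cvgB; [exact: cvg_cst|exact: Fl].
    by rewrite expr2; under eq_fun do rewrite expr2; exact: cvgM.
  apply: (cvgr_to_le cvs).
  apply: filterS FV => y Vy.
  have := UV (x, y) (conj Ux Vy); rewrite -ball_normE /ball_/= => xy.
  rewrite -lee_fin -sumEFin -fsbig_finite//=.
  apply: (@le_trans _ _ (`|x - y| ^+ 2)%:E).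
    by rewrite hilbert_sum_normE; apply: esum_ge; exists A.
  by rewrite lee_fin lerXn2r ?nnegrE ?(ltW e0)// ltW.
have lP : square_summable l.
  have [x xl] := filter_ex (key 1 ltr01).
  have xl2 : square_summable (fun i => x i - l i).
    by apply: le_lt_trans xl _; rewrite ltry.
  have := square_summableD (hilbert_sumP x) (square_summableN xl2).
  by rewrite /square_summable; under eq_esum do rewrite opprB addrC subrK.
apply/cvg_ex; exists (HilbertSum lP).
apply/(@cvgrPdist_le R hilbert_sum _ F _ idfun) => /= e e0.
apply: filterS (key e e0) => x.
have := hilbert_sum_normE (x - HilbertSum lP) => /= <-.
by rewrite lee_fin distrC ler_pXn2r ?nnegrE ?(ltW e0).
Qed.

HB.instance Definition _ :=
  Uniform_isComplete.Build hilbert_sum hilbert_sum_complete.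

Let inner_sqr (x : hilbert_sum) : hilbert_sum_inner x x = `|x| ^+ 2.
Proof. by rewrite hilbert_sum_inner_sqnorm -sqr_hilbert_sum_norm. Qed.

HB.instance Definition _ := CompleteNormedModule_isHilbert.Build R hilbert_sum
  hilbert_sum_innerC hilbert_sum_innerDl hilbert_sum_innerZl inner_sqr.

End hilbert_direct_sum.

Section distance_and_projector.
Context {R : realType} {V : hilbertType R}.
Implicit Types (C : set V) (x : V).

Definition dist_set C x : R := inf [set `|x - y| | y in C].

(* For C nonempty, closed and convex, the point selected by get exists and is
   unique. *)
Definition proj_set C x : V := get [set p | C p /\ `|x - p| = dist_set C x].

End distance_and_projector.

Section proximal_point.
Context {R : realType} {G : hilbertType R}.
Implicit Types (g : G -> \bar R) (x p : G).
Local Open Scope ereal_scope.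

Definition proper_fun g := (forall x, -oo < g x) /\ (exists x, g x < +oo).

Definition convex_efun g := forall x y (t : R), (0 < t < 1)%R ->
  g (t *: x + (1 - t) *: y)%R <= t%:E * g x + (1 - t)%:E * g y.

Definition Gamma0 g :=
  [/\ proper_fun g, lower_semicontinuous g & convex_efun g].

Definition minimizer (h : G -> \bar R) p := forall y, h p <= h y.

(* is_prox g x p reads prox_g x = p. As prox_g is only defined for a proper lower
   semicontinuous convex g, membership of g in that class is part of it. *)
Definition is_prox g x p :=
  Gamma0 g /\
  unique (minimizer (fun y => g y + (2^-1 * `|x - y| ^+ 2)%:E)) p.

End proximal_point.

(* Main.v *)
(* Write p for the image of x under the thresholded projection followed by the
   shift.  The variational inequality of the projector shows that x - p is a
   subgradient of w * d_C at p, so the strongly convex objective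
   w * d_C + |x - .|^2 / 2 exceeds its value at p by at least |. - p|^2 / 2.
   This inequality survives summation over the coordinates, and yields at once
   existence and uniqueness of the minimizer in each H_i and in the direct sum;
   compared with 0 in C_i it gives |p_i| <= |x_i|, hence square summability.
   For (iii), x is recovered from p up to the thresholding: either p is in C and
   is the projection of x, or d_C(p) = d_C(x) - w > 0 and p, x have the same
   projection, on the same ray. *)
Require Import Defs.
From HB Require Import structures.
From mathcomp Require Import all_boot all_order all_algebra finmap.
From mathcomp Require Import all_classical all_reals all_analysis.
From mathcomp Require Import ring lra.
Import Order.TTheory GRing.Theory Num.Theory.
Import numFieldNormedType.Exports.
Local Open Scope classical_set_scope.
Local Open Scope ring_scope.

(** * Continuity of nonexpansive maps and the Cauchy-Schwarz inequality *)

Lemma nonexpansive_continuous (R : realType) (V W : normedModType R)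
  (f : V -> W) : (forall x y, `|f x - f y| <= `|x - y|) -> continuous f.
Proof.
move=> fle x; apply/cvgrPdist_lt => e e0; near=> y.
apply: le_lt_trans (fle x y) _.
by near: y; exact: (@cvgr_dist_lt _ _ _ _ _ idfun x).
Unshelve. all: by end_near. Qed.

(** Expand the square of the norm of [|y| x - |x| y], which is nonnegative. *)
Lemma inner_le_norm (R : realType) (V : hilbertType R) (x y : V) :
  inner x y <= `|x| * `|y|.
Proof.
have [->|x0] := eqVneq x 0.
  by rewrite -(scale0r (0 : V)) innerZl mul0r mulr_ge0.
have [->|y0] := eqVneq y 0.
  by rewrite -(scale0r (0 : V)) innerZr mul0r mulr_ge0.
have nx : 0 < `|x| by rewrite normr_gt0.
have ny : 0 < `|y| by rewrite normr_gt0.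
have := sqr_ge0 `| `|y| *: x + (- `|x|) *: y |.
rewrite normD_sqr !normrZ innerZl innerZr normrN !normr_id => h.
have : `|x| * `|y| * inner x y <= `|x| * `|y| * (`|x| * `|y|) by nra.
by rewrite ler_pM2l// mulr_gt0.
Qed.

(** * Distance to a convex set and nearest points *)

Section convex_distance.
Context {R : realType} {V : hilbertType R} {C : set V}.
Hypothesis C_nonempty : C !=set0.

Lemma dist_set_le x c : C c -> dist_set C x <= `|x - c|.
Proof.
move=> Cc; apply: ge_inf; last by exists c.
by exists 0 => _ [y _ <-].
Qed.

Lemma le_dist_set x (a : R) :
  (forall c, C c -> a <= `|x - c|) -> a <= dist_set C x.
Proof.
move=> ax; apply: lb_le_inf.
  by have [c Cc] := C_nonempty; exists `|x - c|, c.
by move=> _ [c Cc <-]; exact: ax.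
Qed.

Lemma dist_set_ge0 x : 0 <= dist_set C x.
Proof. by apply: le_dist_set. Qed.

Lemma dist_set_mem x : C x -> dist_set C x = 0.
Proof.
move=> Cx; apply/eqP; rewrite eq_le dist_set_ge0 andbT.
by rewrite -(normr0 V) -(subrr x) dist_set_le.
Qed.

Lemma dist_set_lipschitz x y : dist_set C x <= dist_set C y + `|x - y|.
Proof.
rewrite -lerBlDr; apply: le_dist_set => c Cc; rewrite lerBlDr.
apply: (le_trans (dist_set_le x _ Cc)).
by rewrite [leRHS]addrC (le_trans _ (ler_normD _ _))// addrA subrK.
Qed.

Lemma continuous_dist_set : continuous (dist_set C).
Proof.
apply: nonexpansive_continuous => x y; rewrite ler_norml.
have := dist_set_lipschitz x y; have := dist_set_lipschitz y x.
by rewrite (distrC y); lra.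
Qed.

Hypothesis C_convex : convex_set C.

(** [convex_set] takes its scalar in an interval type; this form accepts a real with bounds. *)
Lemma convex_set_comb c c' (t : R) : 0 <= t <= 1 -> C c -> C c' ->
  C (t *: c + (1 - t) *: c').
Proof.
move=> t01 /mem_set Cc /mem_set Cc'; apply: set_mem.
have h : Itv.spec (Itv.num_sem (R := R)) (Itv.Real `[0%Z, 1%Z]) t.
  by rewrite /= /Itv.num_sem /= num_real in_itv.
exact: (C_convex _ _ (Itv.mk h) Cc Cc').
Qed.

(** Combining arbitrary points [c], [c'] of [C] gives a competitor for the left side; the two infima
    are then taken one after the other. *)
Lemma convex_dist_set x y (t : R) : 0 < t < 1 ->
  dist_set C (t *: x + (1 - t) *: y) <=
  t * dist_set C x + (1 - t) * dist_set C y.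
Proof.
move=> /andP[t0 t1].
have s0 : 0 < 1 - t by lra.
have t01 : 0 <= t <= 1 by lra.
rewrite -lerBlDr -ler_pdivrMl//; apply: le_dist_set => c Cc.
rewrite ler_pdivrMl// lerBlDl -lerBlDr -ler_pdivrMl//.
apply: le_dist_set => c' Cc'.
rewrite ler_pdivrMl// lerBlDl.
apply: (le_trans (dist_set_le _ _ (convex_set_comb c c' t t01 Cc Cc'))).
rewrite opprD addrACA -!scalerBr (le_trans (ler_normD _ _))// !normrZ.
by rewrite (ger0_norm (ltW t0)) (ger0_norm (ltW s0)).
Qed.

(** If the inner product were positive, a small step from [p] towards [c] would stay in [C] and come
    closer to [x]. *)
Lemma nearest_inner_le0 x p c : C p -> `|x - p| = dist_set C x -> C c ->
  inner (x - p) (c - p) <= 0.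
Proof.
move=> Cp xp Cc; set a := inner _ _; rewrite leNgt; apply/negP => a0.
(* The step must be short enough that its quadratic cost [t^2 |c - p|^2] stays below the linear gain
   [2 t a]. *)
have [t t0] : exists2 t, 0 < t <= 1 & t * `|c - p| ^+ 2 <= a.
  have b0 : 0 <= `|c - p| ^+ 2 by exact: sqr_ge0.
  have ab : 0 < a + `|c - p| ^+ 2 by lra.
  exists (a / (a + `|c - p| ^+ 2)).
    by rewrite divr_gt0//= ler_pdivrMr// mul1r; lra.
  by rewrite mulrAC ler_pdivrMr//; nra.
case/andP: t0 => t0 t1; apply/negP; rewrite -ltNge.
have t01 : 0 <= t <= 1 by lra.
have := dist_set_le x _ (convex_set_comb c p t t01 Cc Cp).
rewrite -xp.
rewrite -(@ler_pXn2r _ 2)// ?nnegrE//.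
have -> : x - (t *: c + (1 - t) *: p) = (x - p) + (- t) *: (c - p).
  rewrite scalerBl scale1r scalerBr !scaleNr opprK !opprD opprK -!addrA.
  by congr (_ + _); rewrite addrCA.
rewrite [leRHS]normD_sqr innerZr -/a normrZ exprMn real_normK ?num_real//.
rewrite sqrrN => h.
have : t * (2 * a) <= t * (t * `|c - p| ^+ 2) by nra.
by rewrite ler_pM2l//; lra.
Qed.

(** Expanding [|x - p'|^2] around [p], the cross term is nonnegative by the variational inequality,
    which forces [|p' - p|^2 <= 0]. *)
Lemma nearest_unique x p p' : C p -> `|x - p| = dist_set C x ->
  C p' -> `|x - p'| = dist_set C x -> p = p'.
Proof.
move=> Cp xp Cp' xp'.
have h := nearest_inner_le0 x p p' Cp xp Cp'.
have E : x - p' = (x - p) + (- 1) *: (p' - p).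
  by rewrite scaleN1r opprB addrA subrK.
have : `|x - p'| ^+ 2 = `|x - p| ^+ 2 by rewrite xp xp'.
rewrite E [LHS]normD_sqr innerZr scaleN1r normrN => h'.
apply/esym/eqP; rewrite -subr_eq0 -normr_eq0 -sqrf_eq0 eq_le sqr_ge0 andbT.
by lra.
Qed.

Hypothesis C_closed : closed C.

(* The parallelogram identity makes the filter of near-minimizers Cauchy. *)
Lemma exists_nearest x : exists p, C p /\ `|x - p| = dist_set C x.
Proof.
set d := dist_set C x.
have d0 : 0 <= d by exact: dist_set_ge0.
pose B (e : R) := [set c | C c /\ `|x - c| < d + e].
pose F : set_system V := filter_from [set e : R | 0 < e] B.
have FF : ProperFilter F.
  apply: filter_from_proper; last first.
    move=> e e0; apply: contrapT => /nonemptyPn Be.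
    have : d + e <= d.
      apply: le_dist_set => c Cc; rewrite leNgt; apply/negP => h.
      by have : B e c by []; rewrite Be.
    by move: (e0 : 0 < e); lra.
  apply: filter_from_filter; first by exists 1; exact: ltr01.
  move=> e e' /= e0 e'0; exists (Num.min e e'); first by rewrite /= lt_min e0.
  move=> c [Cc h]; split; split=> //; apply: (lt_le_trans h);
    rewrite lerD2l ge_min.
    by rewrite lexx.
  by rewrite lexx orbT.
have Fc : cauchy F.
  apply/cauchy_ballP => e e0.
  (* For two points of [B n], the parallelogram identity gives [|c - c'|^2 <= 4 ((d + n)^2 - d^2)],
     at most [4 (2 d + 1) n] when [n <= 1]. *)
  have [n [n0 n1 ne]] : exists n : R,
      [/\ 0 < n, n <= 1 & 4 * (2 * d + 1) * n < e ^+ 2].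
    exists (Num.min 1 (e ^+ 2 / (8 * (2 * d + 1)))); split.
    - by rewrite lt_min ltr01/= divr_gt0// ?exprn_gt0//; lra.
    - by rewrite ge_min lexx.
    - apply: (@le_lt_trans _ _ (4 * (2 * d + 1) * (e ^+ 2 / (8 * (2 * d + 1))))).
        by rewrite ler_wpM2l ?ge_min ?lexx ?orbT//; lra.
      have -> : 4 * (2 * d + 1) * (e ^+ 2 / (8 * (2 * d + 1))) = e ^+ 2 / 2.
        by field; lra.
      by have : 0 < e ^+ 2 by [rewrite exprn_gt0|]; lra.
  exists (B n, B n); first by split; exists n.
  move=> [c c'] [/= [Cc cn] [Cc' cn']]; rewrite -ball_normE /ball_/=.
  rewrite -(@ltr_pXn2r _ 2)// ?nnegrE ?(ltW e0)//; apply: le_lt_trans ne.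
  have half01 : 0 <= (2^-1 : R) <= 1 by lra.
  have := dist_set_le x _ (convex_set_comb c c' 2^-1 half01 Cc Cc').
  rewrite -/d.
  have -> : x - (2^-1 *: c + (1 - 2^-1) *: c') = 2^-1 *: ((x - c) + (x - c')).
    have -> : 1 - 2^-1 = 2^-1 :> R by field.
    rewrite -scalerDr addrACA [in RHS]scalerDr -opprD scalerN; congr (_ - _).
    by rewrite scalerDr -scalerDl -[LHS]scale1r; congr (_ *: _); field.
  rewrite -(@ler_pXn2r _ 2)// ?nnegrE// normrZ exprMn ger0_norm; last lra.
  rewrite (normD_sqr (x - c)).
  have -> : c - c' = (x - c') + (-1) *: (x - c).
    by rewrite scaleN1r opprB [RHS]addrC addrA subrK.
  rewrite (normD_sqr (x - c')) innerZr scaleN1r normrN (innerC (x - c')).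
  have : `|x - c| ^+ 2 <= (d + n) ^+ 2
    by rewrite lerXn2r ?nnegrE ?(ltW cn)//; lra.
  have : `|x - c'| ^+ 2 <= (d + n) ^+ 2
    by rewrite lerXn2r ?nnegrE ?(ltW cn')//; lra.
  by nra.
have Fp : F --> lim F by exact: cauchy_cvg.
set p := lim F in Fp.
have Cp : C p.
  by apply: (closed_cvg (F := F) (u_ := idfun) C) => //;
    exists 1; [exact: ltr01|move=> c []].
exists p; split => //; apply/eqP; rewrite eq_le dist_set_le// andbT.
apply/ler_addgt0Pr => e e0.
have : `|x - c| @[c --> F] --> `|x - p|.
  by apply: cvg_norm; apply: cvgB Fp; exact: cvg_cst.
move/cvgr_to_le; apply; exists e => //= c [_ h]; exact: ltW.
Qed.

Lemma proj_setP x : C (proj_set C x) /\ `|x - proj_set C x| = dist_set C x.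
Proof. by have := getPex (exists_nearest x). Qed.


(** * The proximity operator of a multiple of the distance *)

Definition threshold_proj (w : R) x :=
  if w < dist_set C x then x else proj_set C x.

Definition shift_to_set (w : R) x :=
  if x \in C then x
  else x + (w / dist_set C x) *: (proj_set C x - x).

(** The two factors are spelled as [Q] and [S] in the theorem, so that [F i] is convertible to
    [prox_dist]. *)
Definition prox_dist (w : R) x := shift_to_set w (threshold_proj w x).

Lemma prox_dist_near w x : dist_set C x <= w -> prox_dist w x = proj_set C x.
Proof.
move=> xw; rewrite /prox_dist /threshold_proj ltNge xw/= /shift_to_set.
by rewrite mem_set//; have [] := proj_setP x.
Qed.

Lemma prox_dist_far w x : 0 < w -> w < dist_set C x ->
  prox_dist w x = x + (w / dist_set C x) *: (proj_set C x - x).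
Proof.
move=> w0 xw; rewrite /prox_dist /threshold_proj xw /shift_to_set.
rewrite memNset// => /dist_set_mem x0.
by move: xw; rewrite x0; lra.
Qed.

Lemma prox_dist_far_proj w x : 0 < w -> w < dist_set C x ->
  prox_dist w x - proj_set C x =
  (1 - w / dist_set C x) *: (x - proj_set C x).
Proof.
move=> w0 xw; rewrite prox_dist_far// scalerBl scale1r -[in RHS]scalerN opprB.
by rewrite addrAC.
Qed.

(** The distance is bounded above through [proj_set C x] and below by the Lipschitz property, since
    [x] is moved by exactly [w]. Hence [proj_set C x] is also nearest to the image. *)
Lemma dist_prox_far w x : 0 < w -> w < dist_set C x ->
  `|prox_dist w x - proj_set C x| = dist_set C (prox_dist w x) /\
  dist_set C (prox_dist w x) = dist_set C x - w.
Proof.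
move=> w0 xw; have [CP xP] := proj_setP x.
have d0 : 0 < dist_set C x by lra.
have pP : `|prox_dist w x - proj_set C x| = dist_set C x - w.
  rewrite prox_dist_far_proj// normrZ xP ger0_norm; last first.
    by rewrite subr_ge0 ler_pdivrMr// mul1r ltW.
  by field; lra.
suff pd : dist_set C (prox_dist w x) = dist_set C x - w by rewrite pP pd.
apply/eqP; rewrite eq_le -{1}pP dist_set_le//= lerBlDr.
apply: (le_trans (dist_set_lipschitz x (prox_dist w x))).
rewrite lerD2l prox_dist_far// opprD addrA subrr sub0r normrN normrZ distrC xP.
by rewrite ger0_norm ?divr_ge0 ?(ltW w0) ?(ltW d0)// divfK ?gt_eqF.
Qed.

(** The distance from the common image to [C] is zero in the near case and positive in the far case,
    so it tells the cases apart. *)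
Lemma threshold_proj_inj w x y : 0 < w ->
  prox_dist w x = prox_dist w y -> threshold_proj w x = threshold_proj w y.
Proof.
move=> w0; rewrite /threshold_proj.
have near0 z : dist_set C z <= w -> dist_set C (prox_dist w z) = 0.
  by move=> zw; rewrite prox_dist_near// dist_set_mem//; have [] := proj_setP z.
have [xw|xw] := ltP w (dist_set C x); have [yw|yw] := ltP w (dist_set C y) => E.
- have [Px Dx] := dist_prox_far w x w0 xw.
  have [Py Dy] := dist_prox_far w y w0 yw.
  (* The image determines both the distance and, by uniqueness of nearest points, the projection;
     the nonzero ray factor then cancels. *)
  have dxy : dist_set C x = dist_set C y by move: Dx Dy; rewrite E; lra.
  have PP : proj_set C x = proj_set C y.
    move: Px; rewrite E => Px.
    have [Cx _] := proj_setP x; have [Cy _] := proj_setP y.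
    exact: (nearest_unique (prox_dist w y)).
  have := prox_dist_far_proj w x w0 xw.
  rewrite E PP dxy prox_dist_far_proj// => /scalerI.
  have k0 : 1 - w / dist_set C y != 0.
    by rewrite gt_eqF// subr_gt0 ltr_pdivrMr ?mul1r//; lra.
  by move=> /(_ k0)/addIr.
- have [_] := dist_prox_far w x w0 xw; rewrite E near0// => h; exfalso; lra.
- have [_] := dist_prox_far w y w0 yw; rewrite -E near0// => h; exfalso; lra.
- by rewrite -(prox_dist_near w)// E prox_dist_near.
Qed.

(** It suffices to bound the left side by [w |y - c|] for each [c] in [C]. Splitting at [c],
    Cauchy-Schwarz controls the part along [y - c] and the variational inequality makes the part
    along [c - proj_set C x] nonpositive. *)
Lemma prox_dist_subgradient w x y : 0 < w ->
  w * dist_set C (prox_dist w x) + inner (x - prox_dist w x) (y - prox_dist w x)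
  <= w * dist_set C y.
Proof.
move=> w0; have [CP xP] := proj_setP x.
rewrite -ler_pdivrMl//; apply: le_dist_set => c Cc; rewrite ler_pdivrMl//.
have uc := nearest_inner_le0 x _ c CP xP Cc.
have CS := inner_le_norm _ _ (x - proj_set C x) (y - c).
rewrite xP in CS.
have [xw|xw] := ltP w (dist_set C x); last first.
  rewrite prox_dist_near// dist_set_mem// mulr0 add0r.
  have -> : y - proj_set C x = (y - c) + (c - proj_set C x).
    by rewrite addrA subrK.
  rewrite innerDr.
  have : dist_set C x * `|y - c| <= w * `|y - c| by rewrite ler_wpM2r.
  by lra.
have [_ ->] := dist_prox_far w x w0 xw.
set d := dist_set C x in xP CS xw *.
have d0 : 0 < d by lra.
have -> : y - prox_dist w x = (y - c) + (c - proj_set C x)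
    + (- (1 - w / d)) *: (x - proj_set C x).
  by rewrite scaleNr -prox_dist_far_proj// addrA subrK opprB addrA subrK.
have -> : x - prox_dist w x = (w / d) *: (x - proj_set C x).
  by rewrite prox_dist_far// opprD addrA subrr sub0r -scalerN opprB.
rewrite innerZl (innerDr _ (_ + _)) (innerDr _ (y - c)) innerZr inner_normE xP.
set a := inner _ (y - c) in CS *; set b := inner _ (c - _) in uc *.
(* The ray contributes [- w (d - w)], which cancels the value of the function at the image. *)
have -> : w * (d - w) + w / d * (a + b + - (1 - w / d) * d ^+ 2) =
  w * ((a + b) / d) by field; lra.
by rewrite ler_pM2l// ler_pdivrMr// mulrC; lra.
Qed.

(* The objective is 1-strongly convex, hence grows quadratically away from its
   minimizer. *)
Lemma prox_dist_growth w x y : 0 < w ->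
  w * dist_set C (prox_dist w x) + 2^-1 * `|x - prox_dist w x| ^+ 2
    + 2^-1 * `|y - prox_dist w x| ^+ 2
  <= w * dist_set C y + 2^-1 * `|x - y| ^+ 2.
Proof.
move=> w0; have := prox_dist_subgradient w x y w0.
set p := prox_dist w x.
have -> : x - y = (x - p) + (- 1) *: (y - p).
  by rewrite scaleN1r opprB addrA subrK.
by rewrite (normD_sqr (x - p)) innerZr scaleN1r normrN; lra.
Qed.

End convex_distance.

(** * Quadratic growth as a criterion for proximal points *)

Section prox_criterion.
Context {R : realType} {G : hilbertType R}.
Local Open Scope ereal_scope.

(** Dropping the last square gives minimality; testing at another minimizer [p'] forces
    [|p' - p|^2 <= 0]. *)
Lemma is_prox_growth (g : G -> \bar R) x p : Gamma0 g ->
  (forall y, g p + (2^-1 * `|x - p| ^+ 2)%:E + (2^-1 * `|y - p| ^+ 2)%:E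
     <= g y + (2^-1 * `|x - y| ^+ 2)%:E) ->
  is_prox g x p.
Proof.
move=> G0 gp; split => //.
have pmin : minimizer (fun y => g y + (2^-1 * `|x - y| ^+ 2)%:E) p.
  move=> y; apply: le_trans (gp y).
  by rewrite leeDl// lee_fin mulr_ge0// ?invr_ge0// sqr_ge0.
split => // p' p'min.
have [[gNy [y0 gy0]] _ _] := G0.
(* Cancelling [g p] in the extended reals requires it to be finite, which properness and minimality
   provide. *)
have gpfin : g p \is a fin_num.
  rewrite fin_numElt gNy/=.
  have : g p + (2^-1 * `|x - p| ^+ 2)%:E < +oo.
    by apply: le_lt_trans (pmin y0) _; rewrite lte_add_pinfty// ltry.
  by apply: le_lt_trans; rewrite leeDl// lee_fin mulr_ge0// ?invr_ge0// sqr_ge0.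
have := le_trans (gp p') (p'min p).
rewrite -(fineK gpfin) -!EFinD lee_fin => h.
apply/esym/eqP; rewrite -subr_eq0 -normr_eq0 -sqrf_eq0 eq_le sqr_ge0 andbT; lra.
Qed.

End prox_criterion.

(** * Semicontinuity and convexity of distances and of sums over coordinates *)

Lemma Gamma0_dist (R : realType) (V : hilbertType R) (C : set V) (w : R) :
  C !=set0 -> convex_set C -> 0 < w ->
  Gamma0 (fun y => (w * dist_set C y)%:E).
Proof.
move=> C0 Cc w0; split.
- by split=> [x|]; [exact: ltNyr | exists 0; exact: ltry].
- move=> x a; rewrite lte_fin => ax.
  exists [set y | a < w * dist_set C y] => //.
  have : w * dist_set C y @[y --> x] --> w * dist_set C x.
    by apply: cvgMr; exact: continuous_dist_set.
  by move=> /cvgr_gt; apply.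
- move=> x y t t01; rewrite -!EFinM -EFinD lee_fin.
  rewrite !(mulrCA _ w) -mulrDr ler_pM2l//.
  exact: convex_dist_set.
Qed.

Lemma continuous_coord (R : realType) (I : choiceType) (H : I -> hilbertType R)
  (i : I) : continuous (fun x : hilbert_sum H => x i).
Proof.
by apply: nonexpansive_continuous => x y; exact: (coord_le_norm (x - y)).
Qed.

(** [\esum] is a supremum of finite partial sums: one of them already exceeds [a] at [x], and by
    continuity still does nearby. *)
Lemma lsc_esum (R : realType) (I : choiceType) (T : topologicalType)
  (g : I -> T -> R) : (forall i, continuous (g i)) ->
  lower_semicontinuous (fun x => \esum_(i in [set: I]) (g i x)%:E)%E.
Proof.
move=> gc x a /ereal_sup_gt[_ [A [finA AT] <-]].
rewrite fsbig_finite//= sumEFin lte_fin => aA.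
exists [set y | a < \sum_(i <- fset_set A) g i y].
  have : \sum_(i <- fset_set A) g i y @[y --> x] -->
      \sum_(i <- fset_set A) g i x.
    by apply: cvg_big => [|i _]; [exact: add_continuous|exact: gc].
  by move=> /cvgr_gt; apply.
move=> y /= ay; apply: (@lt_le_trans _ _ (\sum_(i <- fset_set A) g i y)%:E).
  by rewrite lte_fin.
by apply: esum_ge; exists A => //; rewrite fsbig_finite//= sumEFin.
Qed.

Section separable_sum.
Context {R : realType} {I : choiceType} {H : I -> hilbertType R}.
Context {g : forall i, H i -> R}.
Hypothesis g_ge0 : forall i y, 0 <= g i y.

Let f (x : hilbert_sum H) := (\esum_(i in [set: I]) (g i (x i))%:E)%E.

Lemma lsc_separable_sum : (forall i, continuous (g i)) ->
  lower_semicontinuous f.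
Proof.
move=> gc; apply: (lsc_esum _ _ (hilbert_sum H) (fun i x => g i (x i))) => //.
by move=> i x; apply: continuous_comp; [exact: continuous_coord|exact: gc].
Qed.

Lemma convex_separable_sum :
  (forall i x y (t : R), 0 < t < 1 ->
     g i (t *: x + (1 - t) *: y) <= t * g i x + (1 - t) * g i y) ->
  convex_efun f.
Proof.
move=> gc x y t t01; have [t0 s0] : 0 <= t /\ 0 <= 1 - t by lra.
rewrite /f -!esumTZ// -esumTD; try by move=> i; rewrite mulr_ge0.
by apply: le_esumT => i; exact: gc.
Qed.

(** The squared norm is itself a sum over coordinates, so the inequalities add up; stated in the
    extended reals, this also covers [f y = +oo]. *)
Lemma growth_separable_sum (x p y : hilbert_sum H) :
  (forall i, g i (p i) + 2^-1 * `|x i - p i| ^+ 2 + 2^-1 * `|y i - p i| ^+ 2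
     <= g i (y i) + 2^-1 * `|x i - y i| ^+ 2) ->
  (f p + (2^-1 * `|x - p| ^+ 2)%:E + (2^-1 * `|y - p| ^+ 2)%:E
     <= f y + (2^-1 * `|x - y| ^+ 2)%:E)%E.
Proof.
move=> h.
have n0 (u : hilbert_sum H) i : 0 <= `|u i| ^+ 2 by exact: sqr_ge0.
have h0 : 0 <= 2^-1 :> R by [].
have n20 (u : hilbert_sum H) i : 0 <= 2^-1 * `|u i| ^+ 2 by exact: mulr_ge0.
have E (u : hilbert_sum H) : (2^-1 * `|u| ^+ 2)%:E =
    (\esum_(i in [set: I]) (2^-1 * `|u i| ^+ 2)%:E)%E.
  by rewrite EFinM hilbert_sum_normE esumTZ.
rewrite !E /f -!esumTD//; last first.
  by move=> i; rewrite addr_ge0.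
exact: le_esumT.
Qed.

End separable_sum.

Theorem proposition2p14 (R : realType) (I : countType) (H : I -> hilbertType R)
    (xbar : hilbert_sum H) (omega : I -> R) (C : forall i, set (H i))
    (omega_gt0 : forall i, 0 < omega i)
    (C_nonempty : forall i, C i !=set0)
    (C_closed : forall i, closed (C i))
    (C_convex : forall i, convex_set (C i))
    (C_0 : infinite_set [set: I] -> forall i, C i 0) :
  let Q := fun (i : I) (x : H i) =>
    if omega i < dist_set (C i) x then x else proj_set (C i) x in
  let q := fun i : I => Q i (xbar i) in
  let S := fun (i : I) (x : H i) =>
    if x \in C i then x
    else x + (omega i / dist_set (C i) x) *: (proj_set (C i) x - x) in
  let F := fun i : I => S i \o Q i in
  let f := fun x : hilbert_sum H =>
    (\esum_(i in [set: I]) (omega i * dist_set (C i) (x i))%:E)%E in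
  (forall (i : I) (x : H i),
    is_prox (fun y : H i => (omega i * dist_set (C i) y)%:E) x (F i x)) /\
  exists p : hilbert_sum H,
    [/\ forall i, p i = S i (q i),
        is_prox f xbar p
      & forall x : hilbert_sum H,
          (forall i, Q i (x i) = q i) <-> is_prox f x p].
Proof.
move=> Q q S F f.
have g_ge0 i (y : H i) : 0 <= omega i * dist_set (C i) y.
  by rewrite mulr_ge0 ?dist_set_ge0 ?ltW.
have growth i (x y : H i) : omega i * dist_set (C i) (F i x)
    + 2^-1 * `|x - F i x| ^+ 2 + 2^-1 * `|y - F i x| ^+ 2
    <= omega i * dist_set (C i) y + 2^-1 * `|x - y| ^+ 2.
  exact: prox_dist_growth.
split=> [i x|].
  apply: is_prox_growth; first exact: Gamma0_dist.
  by move=> y; rewrite -!EFinD lee_fin; exact: growth.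
have esum_finI (a : I -> R) : finite_set [set: I] -> (forall i, 0 <= a i) ->
    (\esum_(i in [set: I]) (a i)%:E < +oo)%E.
  move=> finI a0; rewrite esum_fset// => [|i _]; last by rewrite lee_fin.
  by rewrite fsbig_finite//= sumEFin ltry.
have Fsummable (x : hilbert_sum H) : square_summable (fun i => F i (x i)).
  have [finI|infI] := pselect (finite_set [set: I]).
    by apply: esum_finI => // i; exact: sqr_ge0.
  apply: le_lt_trans (hilbert_sumP x); apply: le_esumT => i.
  (* For infinite [I], comparison with [0] in [C i] gives [|F i (x i)| <= |x i|]; for finite [I],
     every family is summable. *)
  have := growth i (x i) 0.
  rewrite (dist_set_mem (C_nonempty i) 0); last exact: C_0.
  rewrite sub0r normrN subr0 mulr0 add0r.
  have := g_ge0 i (F i (x i)); have := sqr_ge0 `|x i - F i (x i)|; lra.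
pose g i (y : H i) := omega i * dist_set (C i) y.
pose P x := HilbertSum (Fsummable x).
have f0 : exists x, (f x < +oo)%E.
  exists 0; rewrite /f; have [finI|infI] := pselect (finite_set [set: I]).
    exact: esum_finI.
  by rewrite esum1// => i _; rewrite dist_set_mem ?mulr0//; exact: C_0.
have Gf : Gamma0 f.
  split.
  - split=> // x; apply: (@lt_le_trans _ _ 0%E); first exact: ltNy0.
    exact: esumT_ge0.
  - apply: (lsc_separable_sum (g := g)) => i x.
    by apply: cvgMr; exact: continuous_dist_set.
  - apply: (convex_separable_sum (g := g)) => // i x y t t01.
    rewrite !(mulrCA _ (omega i)) -mulrDr ler_pM2l//.
    exact: convex_dist_set.
have Pprox x : is_prox f x (P x).
  apply: is_prox_growth => // y.
  by apply: (growth_separable_sum (g := g)) => // i; exact: growth.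
exists (P xbar); split=> // x; split=> [Qx|[_ xp]].
  (* Each coordinate of [P x] depends on [x i] only through [Q i (x i)]. *)
  suff -> : P xbar = P x by [].
  by apply: hilbert_sum_ext => i; rewrite [RHS]/= /F /= Qx.
(* Uniqueness of the minimizer yields [P x = P xbar]; coordinatewise, the thresholded projections
   then agree. *)
have [_ /(_ _ (proj1 xp)) Ex] := (Pprox x).2.
move=> i; apply: (threshold_proj_inj _ _ _ (omega i)) => //.
by have := congr1 (fun z : hilbert_sum H => z i) Ex.
Qed.
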